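(* Let $(M,\langle\,,\rangle)$ be a connected Riemannian manifold of dimension $m\ge 2$, let $T$ be a symmetric positive semi-definite $(2,0)$-tensor field on $M$, $X$ a vector field on $M$, and let $L=L_{T,X}$ be the operator $$Lu=\operatorname{div}\big(T(\nabla u,\cdot)^\sharp\big)-\langle X,\nabla u\rangle ,\qquad u\in\mathcal C^2(M).$$ Let $q\in\mathcal C^0(M)$, $q\ge 0$, be such that $q(x)>0$ outside a compact set. Let $\gamma\in\mathcal C^2(M)$ be such that (i) $\gamma(x)\to+\infty$ as $x\to\infty$, (ii) $q(x)L\gamma(x)\le B$ outside a compact subset of $M$, (iii) $|\nabla\gamma|\le A$ outside a compact subset of $M$, for some constants $A,B>0$. If $u\in\mathcal C^2(M)$ and $u^*=\sup_M u<+\infty$, then there exists a sequence $\{x_k\}\subset M$ such that for each $k\in\mathbb N$ ($k\ge1$) $$\text{a) } u(x_k)>u^*-\frac1k,\qquad \text{b) } q(x_k)Lu(x_k)<\frac1k,\qquad \text{c) } |\nabla u(x_k)|<\frac1k .$$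
   Context: $M$ is not assumed to be (geodesically) complete. $T$ is viewed as a field of symmetric bilinear forms on tangent spaces, regular enough that $\operatorname{div}T$ is defined; $\sharp:T^*M\to TM$ is the musical isomorphism. Equivalently, $Lu=\operatorname{tr}(T\circ\operatorname{Hess}(u))+(\operatorname{div}T)(\nabla u)-\langle X,\nabla u\rangle$, where $\operatorname{div}T$ is the 1-form obtained by tracing $\nabla T$. ''As $x\to\infty$'' means as $x$ leaves every compact subset of $M$. *)

(* Defs.v *)
(* Built on MathComp and MathComp-Analysis. *)
From mathcomp Require Export all_boot all_order all_algebra.
From mathcomp Require Export all_classical all_reals all_analysis.

Set Implicit Arguments.
Unset Strict Implicit.
Unset Printing Implicit Defensive.

Import Order.TTheory GRing.Theory Num.Theory.
Import numFieldNormedType.Exports.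

Local Open Scope classical_set_scope.
Local Open Scope ring_scope.

(* For a finite-dimensional domain V this is the usual class C^k on an open
   set U: one differentiates k times in arbitrary directions. *)
Fixpoint Ck (R : realType) (V W : normedModType R) (k : nat) (U : set V)
    (f : V -> W) : Prop :=
  match k with
  | 0 => forall x, U x -> {for x, continuous f}
  | k'.+1 => (forall x, U x -> differentiable f x) /\
             (forall v, Ck k' U ('D_v f))
  end.

Definition smooth (R : realType) (V W : normedModType R) (U : set V)
    (f : V -> W) : Prop := forall k, Ck k U f.

(* [coord] and [param] are total functions; they are only meaningful on [cdom]
   and [cimg] respectively, where they are inverse homeomorphisms. *)
Record chart (R : realType) (m : nat) (S : topologicalType) := Chart {
  cdom : set S;
  cimg : set 'rV[R]_m;
  coord : S -> 'rV[R]_m;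
  param : 'rV[R]_m -> S;
  cdom_open : open cdom;
  cimg_open : open cimg;
  coord_img : forall p, cdom p -> cimg (coord p);
  param_dom : forall x, cimg x -> cdom (param x);
  coordK : forall p, cdom p -> param (coord p) = p;
  paramK : forall x, cimg x -> coord (param x) = x;
  coord_continuous : forall p, cdom p -> {for p, continuous coord};
  param_continuous : forall x, cimg x -> {for x, continuous param} }.

Definition overlap (R : realType) (m : nat) (S : topologicalType)
    (c c' : chart R m S) : set 'rV[R]_m :=
  cimg c `&` param c @^-1` cdom c'.

Definition transition (R : realType) (m : nat) (S : topologicalType)
    (c c' : chart R m S) : 'rV[R]_m -> 'rV[R]_m :=
  coord c' \o param c.

(* The atlas need not be maximal.  [chart_at p] is an arbitrary chart of the
   atlas around p, in which the tensorial (hence chart-independent) quantities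
   at p are evaluated. *)
Record manifold (R : realType) (m : nat) := Manifold {
  carrier :> topologicalType;
  atlas : set (chart R m carrier);
  chart_at : carrier -> chart R m carrier;
  chart_at_atlas : forall p, atlas (chart_at p);
  chart_at_dom : forall p, cdom (chart_at p) p;
  transition_smooth : forall c c', atlas c -> atlas c' ->
    smooth (overlap c c') (transition c c');
  manifold_hausdorff : hausdorff_space carrier;
  manifold_second_countable : @second_countable carrier }.

Definition is_Ck (R : realType) (m : nat) (M : manifold R m) (k : nat)
    (u : M -> R) : Prop :=
  forall c, atlas c -> Ck k (cimg c) (u \o param c).

(* A tensor field is the family of its component matrices in the charts of the
   atlas, subject to the tensorial change of coordinates.  Tangent vectors are
   row vectors, so that the differential of a transition map f at x sends v to
   v *m 'J f x. *)
Record vector_field (R : realType) (m : nat) (M : manifold R m) := VectorField {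
  vector_comp :> chart R m M -> 'rV[R]_m -> 'rV[R]_m;
  vector_compE : forall c c' x, atlas c -> atlas c' -> overlap c c' x ->
    vector_comp c' (transition c c' x) =
      vector_comp c x *m 'J (transition c c') x }.

Record bilinear_field (R : realType) (m : nat) (M : manifold R m) :=
  BilinearField {
  bilinear_comp :> chart R m M -> 'rV[R]_m -> 'M[R]_m;
  bilinear_compE : forall c c' x, atlas c -> atlas c' -> overlap c c' x ->
    bilinear_comp c x =
      'J (transition c c') x *m bilinear_comp c' (transition c c' x)
        *m ('J (transition c c') x)^T }.

Definition form_at (R : realType) (m : nat) (b : 'M[R]_m) (v w : 'rV[R]_m) : R :=
  (v *m b *m w^T) 0 0.

Definition symmetric_field (R : realType) (m : nat) (M : manifold R m)
    (T : bilinear_field M) : Prop :=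
  forall c x, atlas c -> cimg c x ->
    forall v w, form_at (T c x) v w = form_at (T c x) w v.

Definition psd_field (R : realType) (m : nat) (M : manifold R m)
    (T : bilinear_field M) : Prop :=
  forall c x, atlas c -> cimg c x -> forall v, 0 <= form_at (T c x) v v.

Definition differentiable_field (R : realType) (m : nat) (M : manifold R m)
    (T : bilinear_field M) : Prop :=
  forall c x, atlas c -> cimg c x -> differentiable (T c) x.

Record riemannian_metric (R : realType) (m : nat) (M : manifold R m) :=
  RiemannianMetric {
  metric_form :> bilinear_field M;
  metric_sym : symmetric_field metric_form;
  metric_pos : forall c x, atlas c -> cimg c x ->
    forall v, v != 0 -> 0 < form_at (metric_form c x) v v;
  metric_smooth : forall c, atlas c -> smooth (cimg c) (metric_form c) }.

Section Operators.
Variables (R : realType) (m : nat) (M : manifold R m) (g : riemannian_metric M).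
Implicit Types (c : chart R m M) (x : 'rV[R]_m) (u : M -> R).

Definition partial (f : 'rV[R]_m -> R) (i : 'I_m) : 'rV[R]_m -> R :=
  'D_(delta_mx 0 i) f.

(* Covectors are row vectors as well: w stands for v |-> (v *m w^T) 0 0. *)
Definition sharp c x (w : 'rV[R]_m) : 'rV[R]_m := w *m invmx (g c x).

Definition dform u c x : 'rV[R]_m := \row_i partial (u \o param c) i x.

Definition grad u c x : 'rV[R]_m := sharp c x (dform u c x).

(* Christoffel symbols Gamma^k_(ij) of the Levi-Civita connection. *)
Definition christoffel c x (k i j : 'I_m) : R :=
  2^-1 * \sum_l invmx (g c x) k l *
    (partial (fun y => g c y j l) i x + partial (fun y => g c y i l) j x
     - partial (fun y => g c y i j) l x).

(* k-th component of the covariant derivative of Y along the i-th coordinate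
   vector field. *)
Definition nabla c (Y : 'rV[R]_m -> 'rV[R]_m) x (i k : 'I_m) : R :=
  partial (fun y => Y y 0 k) i x + \sum_j christoffel c x k i j * Y x 0 j.

Definition divergence c (Y : 'rV[R]_m -> 'rV[R]_m) x : R :=
  \sum_i nabla c Y x i i.

(* The vector field T(grad u, .)^sharp. *)
Definition flux (T : bilinear_field M) u c x : 'rV[R]_m :=
  sharp c x (grad u c x *m T c x).

Definition grad_norm u (p : M) : R :=
  let c := chart_at p in let x := coord c p in
  Num.sqrt (form_at (g c x) (grad u c x) (grad u c x)).

Definition Lop (T : bilinear_field M) (X : vector_field M) u (p : M) : R :=
  let c := chart_at p in let x := coord c p in
  divergence c (flux T u c) x - form_at (g c x) (X c x) (grad u c x).

End Operators.

Definition cocompact (S : topologicalType) : set_system S :=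
  [set A | exists2 K : set S, compact K & ~` K `<=` A].
Arguments cocompact S : clear implicits.

(* Not a proper filter when S is compact: all conditions "outside a compact
   set", including divergence at infinity, are then void. *)
Global Instance cocompact_filter (S : topologicalType) : Filter (cocompact S).
Proof.
split.
- by exists set0 => //; exact: compact0.
- move=> P Q [K cK KP] [H cH HQ]; exists (K `|` H).
    exact: compactU.
  by move=> x /not_orP[nK nH]; split; [exact: KP|exact: HQ].
- by move=> P Q PQ [K cK KP]; exists K => // x /KP /PQ.
Qed.

(* Main.v *)
(* If u attains its supremum at p, the constant sequence p works.  Otherwise, as
   gamma is proper and u is bounded above, u - e gamma attains its maximum at
   some p for every e > 0.  There grad u = e grad gamma, and L u <= e L gamma
   since the trace of a product of a positive and a negative semi-definite
   matrix is nonpositive.  For e small, u p exceeds both u* - 1/k and the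
   supremum of u over the compact set where the bounds on gamma may fail, so
   these bounds hold at p. *)
Require Import Defs.
From mathcomp Require Import ring lra.
Import Order.TTheory GRing.Theory Num.Theory.
Import numFieldNormedType.Exports.
Local Open Scope classical_set_scope.
Local Open Scope ring_scope.

Set Implicit Arguments.
Unset Strict Implicit.

(** * Positive semi-definite matrices *)

Lemma form_at_sym (R : realType) (n : nat) (b : 'M[R]_n) :
  (forall v w, form_at b v w = form_at b w v) -> b^T = b.
Proof.
move=> bsym; apply/matrixP => i j; rewrite mxE.
have E k l : b k l = form_at b (delta_mx 0 k) (delta_mx 0 l).
  by rewrite /form_at trmx_delta -rowE -colE !mxE.
by rewrite !E.
Qed.

Lemma form_atB_scale (R : realType) (n : nat) (A B : 'M[R]_n) (e : R)
    (v w : 'rV[R]_n) :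
  form_at (A - e *: B) v w = form_at A v w - e * form_at B v w.
Proof.
rewrite /form_at mulmxBr mulmxBl -scalemxAr -scalemxAl.
by move: (v *m A *m w^T) (v *m B *m w^T) => a b; rewrite !mxE.
Qed.

(** Isolates the first coordinate: for fixed [w] the form is a quadratic polynomial in [t], on which
    the square can be completed. *)
Lemma form_at_block (R : realType) (n : nat) (P : 'M[R]_(1 + n)) (t : R)
    (w : 'rV[R]_n) : P^T = P ->
  form_at P (row_mx t%:M w) (row_mx t%:M w) =
    t ^+ 2 * P 0 0 + 2 * t * (ursubmx P *m w^T) 0 0 + form_at (drsubmx P) w w.
Proof.
move=> Psym.
have dl : dlsubmx P = (ursubmx P)^T by rewrite trmx_ursub Psym.
have ul : ulsubmx P = (P 0 0)%:M.
  by rewrite [LHS]mx11_scalar !mxE; congr (P _ _)%:M; exact: val_inj.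
rewrite /form_at -{1}[P]submxK dl ul tr_row_mx mul_row_block mul_row_col tr_scalar_mx.
rewrite !mulmxDl !mul_mx_scalar !mul_scalar_mx -!scalemxAl.
have -> : w *m (ursubmx P)^T = (ursubmx P *m w^T)^T by rewrite trmx_mul trmxK.
move: (ursubmx P *m w^T) (w *m drsubmx P *m w^T) => s f.
by rewrite !mxE /= mulr1n; ring.
Qed.

(** A Cholesky factorization, by induction on the size: the Schur complement of the corner entry [a]
    is again symmetric and positive semi-definite. *)
Lemma psd_factorization (R : realType) (n : nat) (P : 'M[R]_n) :
  P^T = P -> (forall v, 0 <= form_at P v v) -> exists Q : 'M[R]_n, P = Q^T *m Q.
Proof.
elim: n P => [|n IHn] P; first by move=> _ _; exists 0; rewrite [LHS]flatmx0 [RHS]flatmx0.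
rewrite -[n.+1]/(1 + n)%N in P * => Psym Ppsd.
pose a := P 0 0; pose b := ursubmx P; pose C := drsubmx P.
have form_ge0 t w : 0 <= t ^+ 2 * a + 2 * t * (b *m w^T) 0 0 + form_at C w w.
  by rewrite -form_at_block.
have form0 : form_at C 0 0 = 0 by rewrite /form_at mul0mx mul0mx mxE.
have a_ge0 : 0 <= a.
  by have := form_ge0 1 0; rewrite form0 trmx0 mulmx0 mxE; lra.
(* With [a = 0] the form is affine in [t]. If [b 0 j] were nonzero, the value of [t] chosen below
   would make the form equal to [-1]. *)
have b0 : a = 0 -> b = 0.
  move=> a0; apply/rowP => j; rewrite [RHS]mxE; apply/eqP/negP => /negP bj.
  have /= := form_ge0 (- (form_at C (delta_mx 0 j) (delta_mx 0 j) + 1) / (2 * b 0 j))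
                    (delta_mx 0 j).
  rewrite a0 mulr0 add0r trmx_delta -colE [col j b _ _]mxE.
  rewrite [X in X + _](_ : _ =
      - (form_at C (delta_mx 0 j) (delta_mx 0 j) + 1)); last first.
    by field.
  by lra.
have Csym : C^T = C by rewrite trmx_drsub Psym.
have [|w|Q SQ] := IHn (C - a^-1 *: (b^T *m b)).
- by rewrite linearB linearZ /= trmx_mul trmxK Csym.
- rewrite form_atB_scale /form_at.
  have -> : (w *m (b^T *m b) *m w^T) 0 0 = (b *m w^T) 0 0 ^+ 2.
    rewrite mulmxA -mulmxA -[w *m b^T]trmxK trmx_mul trmxK expr2.
    by rewrite [b *m w^T]mx11_scalar tr_scalar_mx mul_scalar_mx !mxE /= !mulr1n.
  (* For [a = 0] the convention [0^-1 = 0] reduces the Schur complement to [C]. Otherwise its value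
     at [w] is the minimum over [t] of the whole form, reached at [t = - s / a]. *)
  have [a0|an0] := eqVneq a 0.
    rewrite a0 invr0 mul0r subr0.
    by have := form_ge0 0 w; rewrite /form_at; lra.
  have := form_ge0 (- (b *m w^T) 0 0 / a) w; rewrite -/(form_at C w w).
  set s := (b *m w^T) 0 0; set f := form_at C w w.
  by have -> : (- s / a) ^+ 2 * a + 2 * (- s / a) * s + f = f - a^-1 * s ^+ 2 by field.
exists (block_mx (Num.sqrt a)%:M ((Num.sqrt a)^-1 *: b) 0 Q).
rewrite tr_block_mx mulmx_block trmx0 !mulmx0 !mul0mx !addr0 -SQ.
have sb : Num.sqrt a *: ((Num.sqrt a)^-1 *: b) = b.
  have [a0|an0] := eqVneq a 0; first by rewrite b0 // !scaler0.
  by rewrite scalerA divff ?scale1r // sqrtr_eq0 -ltNge lt0r an0.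
have -> : ((Num.sqrt a)^-1 *: b)^T *m ((Num.sqrt a)^-1 *: b) = a^-1 *: (b^T *m b).
  by rewrite [(_ *: b)^T]linearZ /= -scalemxAl -scalemxAr scalerA -invfM -expr2 sqr_sqrtr.
rewrite addrC subrK tr_scalar_mx -scalar_mxM -expr2 sqr_sqrtr //.
rewrite mul_scalar_mx mul_mx_scalar.
rewrite sb -[Num.sqrt a *: _^T]linearZ /= sb.
rewrite -[LHS]submxK -/b -/C; congr block_mx.
  by rewrite [LHS]mx11_scalar !mxE; congr (P _ _)%:M; exact: val_inj.
by rewrite trmx_ursub Psym.
Qed.

(** Writing [P = Q^T *m Q], cyclicity turns the trace into that of [Q *m H *m Q^T], whose diagonal
    entries are values of the form of [H] at the rows of [Q]. *)
Lemma mxtrace_psd_nsd_le0 (R : realType) (n : nat) (P H : 'M[R]_n) :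
  P^T = P -> (forall v, 0 <= form_at P v v) ->
  (forall v, form_at H v v <= 0) -> \tr (P *m H) <= 0.
Proof.
move=> Psym Ppsd Hnsd; have [Q ->] := psd_factorization Psym Ppsd.
rewrite -mulmxA mxtrace_mulC; apply: sumr_le0 => i _.
suff -> : (Q *m H *m Q^T) i i = form_at H (row i Q) (row i Q) by exact: Hnsd.
rewrite /form_at -row_mul [LHS]mxE [RHS]mxE.
by apply: eq_bigr => j _; rewrite !mxE.
Qed.

(** * Second-order conditions at a maximum *)

Section Line.
Context {R : realType} {V W : normedModType R}.
Variables (f : V -> W) (x v : V).

(** Both difference quotients are literally the same function, so the equality holds even where no
    derivative exists. *)
Lemma derive_line t :
  'D_1 (fun h : R => f (h *: v + x)) t = 'D_v f (t *: v + x).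
Proof.
rewrite /derive; set F := (X in lim (X @ _)); set G := (X in _ = lim (X @ _)).
suff -> : F = G by [].
by apply/funext => h; rewrite /F /G /= [_%:A]mulr1 scalerDl addrA.
Qed.

Lemma derivable_line t :
  derivable (fun h : R => f (h *: v + x)) t 1 <-> derivable f (t *: v + x) v.
Proof.
rewrite /derivable; set F := (X in cvg (X @ _)); set G := (X in _ <-> cvg (X @ _)).
suff -> : F = G by [].
by apply/funext => h; rewrite /F /G /= [_%:A]mulr1 scalerDl addrA.
Qed.

End Line.

Lemma derive_at_max_real (R : realType) (f : R -> R) :
  (\forall t \near 0, derivable f t 1) -> (forall t, f t <= f 0) ->
  'D_1 f 0 = 0.
Proof.
move=> /nbhs_ballP[e /= e0 df] fmax.
apply: (@derive_val _ _ _ _ _ _ _ (@derive1_at_max _ f (- e) e 0 _ _ _ _)) => //.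
- lra.
- move=> t; rewrite in_itv /= => /andP[te et]; apply: df.
  by rewrite /ball /= sub0r normrN ltr_norml te et.
- by rewrite in_itv /= oppr_lt0 e0.
Qed.

(** The first derivative vanishes at [0]. If the second were positive there, the first would be
    positive just to the right of [0], and the mean value theorem would give [f (e / 2) > f 0]. *)
Lemma derive2_at_max_real (R : realType) (f : R -> R) :
  (\forall t \near 0, derivable f t 1) -> (forall t, f t <= f 0) ->
  derivable ('D_1 f) 0 1 -> 'D_1 ('D_1 f) 0 <= 0.
Proof.
move=> df fmax ddf; rewrite leNgt; apply/negP => d2.
have d10 := derive_at_max_real df fmax.
have d1 : \forall t \near 0, 0 < t -> 0 < 'D_1 f t.
  have := cvgr_gt _ ddf _ d2; rewrite near_withinE. move=> /(_ _)/nbhs_ballP[e e0 He].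
  apply/nbhs_ballP; exists e => // t te t0; have /= := He t te (lt0r_neq0 t0).
  by rewrite addr0 [_%:A]mulr1 d10 subr0 [_ *: _]mulrC pmulr_lgt0 ?invr_gt0.
have /nbhs_ballP[e /= e0 He] : \forall t \near 0, derivable f t 1 /\
    (0 < t -> 0 < 'D_1 f t) by exact: filterI.
have inball t : 0 <= t <= e / 2 -> ball (0 : R) e t.
  by move=> /andP[t0 te]; rewrite /ball /= sub0r normrN ger0_norm //; lra.
have e2 : 0 < e / 2 by lra.
have [t||c] := @MVT R f ('D_1 f) 0 (e / 2) e2.
- rewrite in_itv /= => /andP[t0 te]; apply: derivableP.
  by apply: (He t _).1; apply: inball; rewrite !ltW.
- apply: derivable_within_continuous => t; rewrite in_itv /= => tI.
  by apply: (He t _).1; exact: inball.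
rewrite in_itv /= => /andP[c0 ce] E.
have : 0 < 'D_1 f c * (e / 2 - 0).
  by rewrite subr0 mulr_gt0 //; apply: (He c _).2 => //; apply: inball; rewrite !ltW.
by rewrite -E subr_gt0 ltNge fmax.
Qed.

Section MaxAlongLine.
Context {R : realType} {V : normedModType R}.
Variables (f : V -> R) (x v : V).
Hypothesis df : \forall y \near x, derivable f y v.
Hypothesis fmax : forall y, f y <= f x.

Let df_line : \forall t \near (0 : R), derivable f (t *: v + x) v.
Proof.
have cl : (fun t : R => t *: v + x) @ (0 : R) --> x.
  rewrite -[X in _ --> X]add0r -[X in _ --> X + _](scale0r v).
  by apply: cvgD; [apply: cvgZr_tmp; exact: cvg_id|exact: cvg_cst].
exact: cl df.
Qed.

Lemma derive_at_max : 'D_v f x = 0.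
Proof.
rewrite -[x in LHS]add0r -[X in X + _](scale0r v) -derive_line.
apply: derive_at_max_real => [|t]; last by rewrite scale0r add0r.
by apply: filterS df_line => t /(derivable_line f x v t).2.
Qed.

Lemma derive2_at_max : derivable ('D_v f) x v -> 'D_v ('D_v f) x <= 0.
Proof.
move=> ddf; rewrite -[x in leLHS]add0r -[X in X + _](scale0r v) -derive_line.
have E : (fun t => 'D_v f (t *: v + x)) = 'D_1 (fun t : R => f (t *: v + x)).
  by apply/funext => t; rewrite derive_line.
rewrite E; apply: derive2_at_max_real => [|t|].
- by apply: filterS df_line => t /(derivable_line f x v t).2.
- by rewrite scale0r add0r.
- by rewrite -E; apply: (derivable_line ('D_v f) x v 0).2; rewrite scale0r add0r.
Qed.

End MaxAlongLine.

(** * The operator in a chart *)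

Section DerivableMatrix.
Context {R : realType} {V : normedModType R}.
Variables x v : V.

Lemma derivable_bigsum (I : Type) (r : seq I) (P : pred I) (F : I -> V -> R) :
  (forall i, P i -> derivable (F i) x v) ->
  derivable (fun y => \sum_(i <- r | P i) F i y) x v.
Proof.
move=> dF; elim: r => [|i r IH].
  by under eq_fun do rewrite big_nil; exact: derivable_cst.
under eq_fun do rewrite big_cons.
by case: ifPn => // /dF Fi; exact: derivableD.
Qed.

Lemma derivable_bigprod (I : Type) (r : seq I) (P : pred I) (F : I -> V -> R) :
  (forall i, P i -> derivable (F i) x v) ->
  derivable (fun y => \prod_(i <- r | P i) F i y) x v.
Proof.
move=> dF; elim: r => [|i r IH].
  by under eq_fun do rewrite big_nil; exact: derivable_cst.
under eq_fun do rewrite big_cons.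
by case: ifPn => // /dF Fi; exact: derivableM.
Qed.

Lemma derivable_mulmx m n p (A : V -> 'M[R]_(m, n)) (B : V -> 'M[R]_(n, p)) :
  derivable A x v -> derivable B x v -> derivable (fun y => A y *m B y) x v.
Proof.
move=> /derivable_mxP dA /derivable_mxP dB; apply/derivable_mxP => i j.
under eq_fun do rewrite mxE.
by apply: derivable_bigsum => k _; exact: derivableM.
Qed.

Lemma derivable_det n (A : V -> 'M[R]_n) :
  derivable A x v -> derivable (fun y => \det (A y)) x v.
Proof.
move=> /derivable_mxP dA; apply: derivable_bigsum => s _.
by apply: derivableM; [exact: derivable_cst|apply: derivable_bigprod].
Qed.

Lemma derivable_invmx n (A : V -> 'M[R]_n) :
  (\forall y \near x, A y \in unitmx) ->
  derivable A x v -> derivable (fun y => invmx (A y)) x v.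
Proof.
move=> uA dA; have /derivable_mxP dAij := dA.
(* Near [x] the inverse is given by Cramer's rule, so only determinants and the inverse of a nonzero
   scalar have to be differentiated. *)
apply: (@near_eq_derivable _ _ _
    (fun y => (\det (A y))^-1 *: \adj (A y))).
  by apply: filterS uA => y uAy; rewrite /invmx uAy.
apply/derivable_mxP => i j; under eq_fun do rewrite !mxE.
apply: derivableM.
  apply: derivableV; last exact: derivable_det.
  by have := nbhs_singleton uA; rewrite unitmxE unitfE.
apply: derivableM; first exact: derivable_cst.
apply: derivable_det; apply/derivable_mxP => k l.
under eq_fun do rewrite !mxE.
exact: dAij.
Qed.

End DerivableMatrix.

(** * Coordinate Hessians and comparison at a touching point *)

Section Hessian.
Context {R : realType} {m : nat}.
Implicit Types (f h : 'rV[R]_m -> R) (x v : 'rV[R]_m).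

(** This is not the covariant Hessian: the Christoffel terms are counted among the first-order terms
    in [Lop_symbol]. *)
Definition hessian f x : 'M[R]_m := \matrix_(i, j) partial (partial f j) i x.

Lemma derive_partial f x v :
  differentiable f x -> 'D_v f x = \sum_i v 0 i * partial f i x.
Proof.
move=> df; rewrite deriveE // {1}[v]row_sum_delta linear_sum.
by apply: eq_bigr => i _; rewrite linearZ /partial deriveE.
Qed.

Lemma form_hessian (U : set 'rV[R]_m) f x v :
  open U -> U x -> Ck 2 U f -> form_at (hessian f x) v v = 'D_v ('D_v f) x.
Proof.
move=> oU Ux [df d2f].
have d2fx j : differentiable (partial f j) x by exact: (d2f _).1.
(* The expansion of ['D_v f] in partial derivatives must hold on a neighbourhood of [x], since it is
   differentiated once more. *)
rewrite (@near_eq_derive _ _ _ _ (\sum_j v 0 j *: partial f j)); last first.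
  apply: filterS (open_nbhs_nbhs (conj oU Ux)) => y Uy.
  by rewrite derive_partial ?fct_sumE; last exact: df.
rewrite derive_sum => [|j]; last by apply: derivableZ; exact: diff_derivable.
rewrite /form_at mxE; apply: eq_bigr => j _.
rewrite deriveZ; last exact: diff_derivable.
rewrite derive_partial // !mxE mulrC; congr (_ * _).
by apply: eq_bigr => i _; rewrite mxE.
Qed.

(** Linearity on a whole neighbourhood, so that second derivatives of [f - e *: h] can be computed
    from those of [f] and [h]. *)
Lemma near_deriveB_scale (U : set 'rV[R]_m) f h (e : R) x v :
  open U -> U x -> Ck 2 U f -> Ck 2 U h ->
  \forall y \near x, ('D_v f - e *: 'D_v h) y = 'D_v (f - e *: h) y.
Proof.
move=> oU Ux [df _] [dh _].
apply: filterS (open_nbhs_nbhs (conj oU Ux)) => y Uy.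
have dhy : derivable h y v by apply/diff_derivable/dh.
by rewrite deriveB ?deriveZ //; [apply/diff_derivable/df|exact: derivableZ].
Qed.

Section Touching.
Variables (U : set 'rV[R]_m) (f h : 'rV[R]_m -> R) (e : R) (x : 'rV[R]_m).
Hypotheses (oU : open U) (Ux : U x) (Cf : Ck 2 U f) (Ch : Ck 2 U h).
Hypothesis fh_max : forall y, f y - e * h y <= f x - e * h x.

Let dfh v : \forall y \near x, derivable (f - e *: h) y v.
Proof.
apply: filterS (open_nbhs_nbhs (conj oU Ux)) => y Uy.
apply: derivableB; first exact/diff_derivable/Cf.1.
exact/derivableZ/diff_derivable/Ch.1.
Qed.

Lemma partial_touching i : partial f i x = e * partial h i x.
Proof.
have := derive_at_max (dfh (delta_mx 0 i)) fh_max.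
rewrite -(nbhs_singleton (near_deriveB_scale e _ oU Ux Cf Ch)).
by move/eqP; rewrite subr_eq0 => /eqP.
Qed.

Lemma form_hessian_touching v :
  form_at (hessian f x - e *: hessian h x) v v <= 0.
Proof.
have d2f : derivable ('D_v f) x v by apply/diff_derivable/(Cf.2 v).1.
have d2h : derivable ('D_v h) x v by apply/diff_derivable/(Ch.2 v).1.
have nE := near_deriveB_scale e v oU Ux Cf Ch.
have := derive2_at_max (dfh v) fh_max.
have d2 : derivable ('D_v f - e *: 'D_v h) x v.
  exact: derivableB d2f (derivableZ d2h).
move=> /(_ (near_eq_derivable nE d2)).
rewrite -(near_eq_derive _ nE) (deriveB d2f (derivableZ d2h)) (deriveZ _ d2h).
rewrite -!(form_hessian _ oU Ux) //.
by rewrite form_atB_scale.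
Qed.

End Touching.

End Hessian.

(** * Second-order expansion of the operator *)

Section Operator.
Context {R : realType} {m : nat} {M : manifold R m}.
Variables (g : riemannian_metric M) (T : bilinear_field M) (X : vector_field M).
Hypothesis dT : differentiable_field T.
Implicit Types (c : chart R m M) (u : M -> R).

Lemma metric_unitmx c x : atlas c -> cimg c x -> g c x \in unitmx.
Proof.
move=> ac cx; rewrite unitmxE unitfE; apply/negP => /det0P[v v0 vg].
by have := metric_pos g ac cx v0; rewrite /form_at vg mul0mx mxE ltxx.
Qed.

(* [T] with both indices raised: the principal symbol of [Lop]. *)
Definition symbol c x : 'M[R]_m := invmx (g c x) *m T c x *m invmx (g c x).

Lemma metric_trmx c x : atlas c -> cimg c x -> (g c x)^T = g c x.
Proof. by move=> ac cx; apply: form_at_sym => v w; exact: metric_sym. Qed.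

Lemma symbol_trmx c x : symmetric_field T -> atlas c -> cimg c x ->
  (symbol c x)^T = symbol c x.
Proof.
move=> Tsym ac cx; rewrite /symbol !trmx_mul trmx_inv metric_trmx // mulmxA.
by rewrite (form_at_sym (Tsym _ _ ac cx)).
Qed.

(** A congruence: as [invmx (g c x)] is symmetric, this is the form of [T] at
    [v *m invmx (g c x)]. *)
Lemma symbol_psd c x v : psd_field T -> atlas c -> cimg c x ->
  0 <= form_at (symbol c x) v v.
Proof.
move=> Tpsd ac cx; have := Tpsd _ _ ac cx (v *m invmx (g c x)).
by rewrite /form_at trmx_mul trmx_inv metric_trmx // /symbol !mulmxA.
Qed.

Lemma derivable_symbol c x v : atlas c -> cimg c x -> derivable (symbol c) x v.
Proof.
move=> ac cx.
have dG : derivable (fun y => invmx (g c y)) x v.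
  apply: derivable_invmx; last exact/diff_derivable/((metric_smooth g ac) 1%N).1.
  have : open_nbhs x (cimg c) by split => //; exact: cimg_open.
  by move=> /open_nbhs_nbhs; apply: filterS => y; exact: metric_unitmx.
have dTx : derivable (T c) x v by exact/diff_derivable/dT.
exact: derivable_mulmx (derivable_mulmx dG dTx) dG.
Qed.

Lemma fluxE u c x : flux g T u c x = dform u c x *m symbol c x.
Proof. by rewrite /flux /grad /sharp /symbol !mulmxA. Qed.

(* [b] does not depend on [u], so this exhibits [Lop] as linear without having
   to show that C^2 functions are closed under linear combinations. *)
Lemma Lop_symbol p : exists b : 'cV[R]_m, forall u, is_Ck 2 u ->
  let c := chart_at p in let x := coord c p in
  Lop g T X u p =
    \tr (symbol c x *m hessian (u \o param c) x) + (dform u c x *m b) 0 0.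
Proof.
pose c := chart_at p; pose x := coord c p.
have ac : atlas c by exact: chart_at_atlas.
have cx : cimg c x by exact/coord_img/chart_at_dom.
(* [chi] is the contracted Christoffel symbol and [d] the coordinate divergence of the symbol. The
   remaining term of [b] comes from the drift [X]. *)
pose chi : 'cV[R]_m := \col_j \sum_i christoffel g c x i i j.
pose d : 'cV[R]_m := \col_j \sum_i partial (fun y => symbol c y j i) i x.
exists (symbol c x *m chi + d - (X c x *m g c x *m (invmx (g c x))^T)^T) => u Cu /=.
have [du d2u] := Cu c ac.
have -> : Lop g T X u p =
  divergence g c (flux g T u c) x - form_at (g c x) (X c x) (grad g u c x) by [].
have addE (r s : 'M[R]_1) : (r + s) 0 0 = r 0 0 + s 0 0 by rewrite mxE.
have subE (r s : 'M[R]_1) : (r - s) 0 0 = r 0 0 - s 0 0 by rewrite !mxE.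
rewrite -/c -/x mulmxBr mulmxDr subE addE.
have -> : (dform u c x *m (X c x *m g c x *m (invmx (g c x))^T)^T) 0 0 =
    form_at (g c x) (X c x) (grad g u c x).
  rewrite /form_at /grad /sharp [(dform _ _ _ *m _)^T]trmx_mul !mulmxA.
  by rewrite -[dform _ _ _ in LHS]trmxK -trmx_mul [LHS]mxE.
rewrite !addrA; congr (_ - _).
rewrite /divergence /nabla big_split /= addrAC; congr (_ + _); last first.
  rewrite mulmxA -fluxE mxE exchange_big /=.
  by apply: eq_bigr => j _; rewrite [chi _ _]mxE mulr_sumr;
    apply: eq_bigr => i _; rewrite mulrC.
rewrite mxE; under [X in _ = _ + X]eq_bigr do rewrite [d _ _]mxE mulr_sumr.
rewrite /mxtrace; under [X in _ = X + _]eq_bigr do rewrite mxE.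
rewrite addrC exchange_big /= [X in _ + X]exchange_big -big_split /=.
apply: eq_bigr => i _; rewrite -big_split /=.
have dsym := (derivable_mxP _ _ _).1 (derivable_symbol (v := delta_mx 0 i) ac cx).
have d2 j : derivable (partial (u \o param c) j) x (delta_mx 0 i).
  exact/diff_derivable/(d2u _).1.
rewrite {1}/partial.
(* In the product rule, differentiating the partials of [u] yields the trace term and
   differentiating the symbol yields [d]. *)
have -> : (fun y => flux g T u c y 0 i) =
    \sum_j (partial (u \o param c) j * (fun y => symbol c y j i)).
  apply/funext => y; rewrite fluxE mxE fct_sumE.
  by apply: eq_bigr => j _; rewrite mxE.
rewrite derive_sum => [|j]; last exact: derivableM.
apply: eq_bigr => j _; rewrite deriveM //.
by rewrite [dform _ _ _ _ _]mxE [hessian _ _ _ _]mxE.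
Qed.

(** At a maximum of [u - e * gamma] the differential of [u] is [e] times that of [gamma], so the
    first-order terms of the two sides cancel. What remains is the trace of the symbol against a
    negative semi-definite difference of Hessians. The value [e = 0] covers a maximum of [u]
    itself. *)
Lemma Lop_grad_touching u gamma (e : R) (p : M) :
  symmetric_field T -> psd_field T -> 0 <= e -> is_Ck 2 u -> is_Ck 2 gamma ->
  (forall y, u y - e * gamma y <= u p - e * gamma p) ->
  Lop g T X u p <= e * Lop g T X gamma p /\
  grad_norm g u p = e * grad_norm g gamma p.
Proof.
move=> Tsym Tpsd e0 Cu Cg umax.
pose c := chart_at p; pose x := coord c p.
have ac : atlas c by exact: chart_at_atlas.
have cx : cimg c x by exact/coord_img/chart_at_dom.
(* This holds for every [y], even outside [cimg c]: [param c] is total with values in [M], where the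
   maximum is global. *)
have Umax y : (u \o param c) y - e * (gamma \o param c) y <=
    (u \o param c) x - e * (gamma \o param c) x.
  by rewrite /= /x coordK; [exact: umax|exact: chart_at_dom].
have oc : open (cimg c) by exact: cimg_open.
have dE : dform u c x = e *: dform gamma c x.
  by apply/rowP => i; rewrite !mxE (partial_touching oc cx (Cu c ac) (Cg c ac) Umax).
split; last first.
  rewrite /grad_norm -/c -/x /grad /sharp dE -scalemxAl /form_at.
  rewrite -scalemxAl linearZ /= -scalemxAr -scalemxAl scalerA mxE.
  by rewrite sqrtrM ?mulr_ge0 // -expr2 sqrtr_sqr ger0_norm.
have [b bE] := Lop_symbol p.
rewrite !bE // -/c -/x dE -scalemxAl mulrDr [X in _ + X]mxE lerD2r.
rewrite -subr_le0 -mxtraceZ scalemxAr -linearB /= -mulmxBr.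
apply: mxtrace_psd_nsd_le0.
- exact: symbol_trmx.
- by move=> v; exact: symbol_psd.
- by move=> v; exact: (form_hessian_touching oc cx (Cu c ac) (Cg c ac) Umax).
Qed.

End Operator.

(** * The maximum principle *)

Lemma is_Ck_continuous (R : realType) (m : nat) (M : manifold R m) (k : nat)
    (u : M -> R) : is_Ck k.+1 u -> continuous u.
Proof.
move=> Cu p; pose c := chart_at p.
have cp : cdom c p by exact: chart_at_dom.
have /differentiable_continuous cu : differentiable (u \o param c) (coord c p).
  by apply: (Cu c (chart_at_atlas p)).1; exact: coord_img.
have ccu : {for p, continuous ((u \o param c) \o coord c)}.
  by apply: continuous_comp => //; exact: coord_continuous.
have nE : \forall y \near p, ((u \o param c) \o coord c) y = u y.
  have : open_nbhs p (cdom c) by split => //; exact: cdom_open.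
  by move=> /open_nbhs_nbhs; apply: filterS => y cy; rewrite /= coordK.
apply: (@cvg_trans _ ((u \o param c) \o coord c @ p)); first exact: near_eq_cvg.
by rewrite -[u p](nbhs_singleton nE).
Qed.

Lemma proper_min (R : realType) (S : topologicalType) (f : S -> R) :
  [set: S] !=set0 -> continuous f -> f x @[x --> cocompact S] --> +oo ->
  exists p, forall y, f p <= f y.
Proof.
move=> [x0 _] cf /cvgryPge/(_ (f x0))[K cK Kf].
(* Adding [x0] makes the compact set nonempty and its minimum at most [f x0], hence at most every
   value outside [K]. *)
have K'0 : (K `|` [set x0]) !=set0 by exists x0; right.
have cK' : compact (K `|` [set x0]) by apply: compactU => //; exact: compact_set1.
have [p _ pmin] := compact_EVT_min K'0 cK' (continuous_subspaceT cf).
exists p => y; have [Ky|nKy] := pselect (K y).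
  by apply: pmin; rewrite inE; left.
by apply: le_trans (Kf _ nKy); apply: pmin; rewrite inE; right.
Qed.

(** With [b] an upper bound of [u], the difference exceeds [C] as soon as [gamma] exceeds
    [(C + b) / e]. *)
Lemma cvgry_scaleB (R : realType) (S : Type) (F : set_system S) {FF : Filter F}
    (gamma u : S -> R) (e : R) : 0 < e -> has_ubound (range u) ->
  gamma x @[x --> F] --> +oo -> e * gamma x - u x @[x --> F] --> +oo.
Proof.
move=> e0 [b ub] /cvgryPge gy; apply/cvgryPge => C.
apply: filterS (gy ((C + b) / e)) => x; rewrite ler_pdivrMr // => Cx.
have := ub (u x) (ex_intro2 _ _ x I erefl); lra.
Qed.

Unset Implicit Arguments.
Set Strict Implicit.

Theorem theoremB (R : realType) (m : nat) (M : manifold R m)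
    (g : riemannian_metric M) (T : bilinear_field M) (X : vector_field M)
    (q gamma u : M -> R) (A B : R) :
  (2 <= m)%N ->
  [set: M] !=set0 -> connected [set: M] ->
  symmetric_field T -> psd_field T -> differentiable_field T ->
  continuous q -> (forall p, 0 <= q p) ->
  (\forall p \near cocompact M, 0 < q p) ->
  0 < A -> 0 < B ->
  is_Ck 2 gamma ->
  gamma p @[p --> cocompact M] --> +oo ->
  (\forall p \near cocompact M, q p * Lop g T X gamma p <= B) ->
  (\forall p \near cocompact M, grad_norm g gamma p <= A) ->
  is_Ck 2 u ->
  has_ubound (range u) ->
  exists x : nat -> M, forall k : nat, (1 <= k)%N ->
    [/\ sup (range u) - k%:R^-1 < u (x k),
        q (x k) * Lop g T X u (x k) < k%:R^-1
      & grad_norm g u (x k) < k%:R^-1].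
Proof.
move=> _ M0 _ Tsym Tpsd dT _ q0 _ A0 B0 Cg gy LB gA Cu ub.
have k0 k : (1 <= k)%N -> 0 < k%:R^-1 :> R by move=> ?; rewrite invr_gt0 ltr0n.
have u_le_sup y : u y <= sup (range u) by apply: ub_le_sup => //; exists y.
have [[p pmax]|nmax] := pselect (exists p, forall y, u y <= u p).
  exists (fun=> p) => k /k0 kp.
  have pmax0 y : u y - 0 * gamma y <= u p - 0 * gamma p by rewrite !mul0r !subr0.
  have [Lu gu] := Lop_grad_touching g X dT Tsym Tpsd (lexx 0) Cu Cg pmax0.
  split.
  - suff : sup (range u) <= u p by lra.
    apply: ge_sup => [|_ [y _ <-] //]; by case: M0 => y _; exists (u y), y.
  - rewrite mul0r in Lu; apply: le_lt_trans kp.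
    exact: mulr_ge0_le0.
  - by rewrite gu mul0r.
have [K cK LgK] : \forall p \near cocompact M,
  q p * Lop g T X gamma p <= B /\ grad_norm g gamma p <= A by exact: filterI.
have cu := is_Ck_continuous Cu; have cg := is_Ck_continuous Cg.
(* The maximum of [u] over [K] lies strictly below the supremum, which would otherwise be attained.
   If [K] is empty, any smaller number serves. *)
have [s0 s0sup Ks0] : exists2 s, s < sup (range u) & forall y, K y -> u y <= s.
  have [K0|/set0P/negP/negPn/eqP K0] := pselect (K !=set0); last first.
    by exists (sup (range u) - 1) => [|y]; [lra|rewrite K0].
  have [c _ cmax] := compact_EVT_max K0 cK (continuous_subspaceT cu).
  exists (u c) => [|y Ky]; last by apply: cmax; rewrite inE.
  rewrite ltNge; apply/negP => cs; apply: nmax; exists c => y.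
  exact: le_trans (u_le_sup y) cs.
have [pm pmE] := proper_min M0 cg gy.
suff /choice[x xP] : forall k, exists p, (1 <= k)%N ->
    [/\ sup (range u) - k%:R^-1 < u p, q p * Lop g T X u p < k%:R^-1
      & grad_norm g u p < k%:R^-1] by exists x.
(* At index [0] nothing is claimed and any point will do. *)
move=> k; have [/k0 kp|] := boolP (1 <= k)%N; last by case: M0 => y _; exists y.
(* A point where [u] exceeds [s] satisfies the first conclusion and lies outside [K]. *)
pose s := Num.max s0 (sup (range u) - k%:R^-1).
have ssup : s < sup (range u) by rewrite gt_max s0sup /=; lra.
have [_ [p0 _ <-] sp0] : exists2 r, range u r & s < r.
  have := @sup_adherent _ (range u) (sup (range u) - s); rewrite subr_gt0.
  rewrite subKr; apply => //; split=> //.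
  by case: M0 => y _; exists (u y), y.
(* [D] exceeds by [1] the most that [gamma] can drop below [gamma p0]. Thus [e * D <= u p0 - s]
   keeps [u] strictly above [s] at the maximum point of [u - e * gamma]. *)
pose D := gamma p0 - gamma pm + 1.
have D0 : 0 < D by have := pmE p0; rewrite /D; lra.
(* The added [1] in the last two denominators makes [e * B] and [e * A] strictly smaller than
   [k%:R^-1]. *)
pose e := Num.min ((u p0 - s) / D)
  (Num.min (k%:R^-1 / (B + 1)) (k%:R^-1 / (A + 1))).
have e0 : 0 < e by rewrite !lt_min !divr_gt0 //; lra.
have eD : e * D <= u p0 - s by rewrite -ler_pdivlMr // ge_min lexx.
have eB : e * (B + 1) <= k%:R^-1.
  by rewrite -ler_pdivlMr ?ge_min ?lexx ?orbT //; lra.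
have eA : e * (A + 1) <= k%:R^-1.
  by rewrite -ler_pdivlMr ?ge_min ?lexx ?orbT //; lra.
have cw : continuous (fun y => e * gamma y - u y).
  move=> y; apply: cvgB; last exact: cu.
  by apply: cvgM; [exact: cvg_cst|exact: cg].
have [p pmin] := proper_min M0 cw (cvgry_scaleB e0 ub gy).
(* Maximality gives [u p >= u p0 - e * (gamma p0 - gamma p)], and here [gamma p >= gamma pm]. *)
have sp : s < u p.
  have := pmin p0.
  have : e * gamma pm <= e * gamma p by rewrite ler_pM2l.
  move: eD; rewrite /D; lra.
have nKp : ~ K p by move=> /Ks0; move: sp; rewrite gt_max => /andP[]; lra.
have [LgB ggA] := LgK p nKp.
have pmax y : u y - e * gamma y <= u p - e * gamma p by have := pmin y; lra.
have [Lu gu] := Lop_grad_touching g X dT Tsym Tpsd (ltW e0) Cu Cg pmax.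
exists p => _; split.
- by move: sp; rewrite gt_max => /andP[].
(* The comparison of the operators is multiplied by [q p >= 0]; the bound [B] then applies because
   [p] is outside [K]. *)
- have : q p * Lop g T X u p <= e * (q p * Lop g T X gamma p).
    by rewrite mulrCA ler_wpM2l.
  have : e * (q p * Lop g T X gamma p) <= e * B by rewrite ler_pM2l.
  lra.
- rewrite gu; have : e * grad_norm g gamma p <= e * A by rewrite ler_pM2l.
  lra.
Qed.
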